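(* Let $f,g:\mathbb{R}\times\mathbb{R}\to\mathbb{R}$ be smooth functions of $(x,\alpha)$ and consider the one-dimensional quasilinear differential-algebraic equation $g(x,\alpha)\,\dot x=f(x,\alpha)$ with phase variable $x$ and parameter $\alpha$. Assume that $$g(0,0)=0,\quad g_x(0,0)=0,\quad g_{xx}(0,0)\neq 0,\quad f(0,0)\neq 0,\quad g_\alpha(0,0)\neq 0.$$ Then for all small $\alpha$, by an invertible change of coordinate $x\mapsto\eta$ (depending on $\alpha$) and an invertible change of parameter $\alpha\mapsto\beta$, the equation can be brought near the origin to the normal form $$(\beta+s\,\eta^2+O(\eta^3))\,\dot\eta=1,\qquad s=\operatorname{sign}\frac{g_{xx}(0,0)}{f(0,0)}\in\{+1,-1\}.$$
   Context: Subscripts denote partial derivatives. ''Brought near the origin to a normal form'' means: there are a smooth parameter-dependent change of coordinate $x=X(\eta,\alpha)$ with $X(0,0)=0$, locally invertible in $\eta$ for each small $\alpha$, and a smooth change of parameter $\beta=B(\alpha)$ with $B(0)=0$, invertible near $\alpha=0$, such that for all small $\alpha$ the equation, rewritten in the variable $\eta$ in a neighbourhood of the origin (and after multiplying both sides by a nowhere vanishing function if needed), takes the stated form. The term $O(\eta^3)$ may depend smoothly on the parameter. *)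

(* Defs.v *)
From Stdlib Require Import Reals Lra.
From Coquelicot Require Import Coquelicot.
Open Scope R_scope.

(** Functions of two variables [(x, alpha)] are curried, with the phase
    variable first.  [ex_diff_n F n] on an open set says that all iterated
    partial derivatives of order at most [n], in any order of differentiation,
    exist and are jointly continuous; hence C^infinity below. *)
Definition smooth_2d (F : R -> R -> R) : Prop :=
  forall x y n, ex_diff_n F n x y.

Definition smooth_2d_near0 (F : R -> R -> R) : Prop :=
  locally_2d (fun x y => forall n, ex_diff_n F n x y) 0 0.

Definition smooth_near0 (F : R -> R) : Prop :=
  locally 0 (fun x => forall n, ex_derive_n F n x).

(** [locally_2d] ranges over a product neighbourhood of the origin, so the
    phase-variable neighbourhood does not shrink as the parameter varies. *)
Definition coordinate_change (X : R -> R -> R) : Prop :=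
  X 0 0 = 0 /\ smooth_2d_near0 X /\
  exists Y : R -> R -> R,
    smooth_2d_near0 Y /\
    locally_2d (fun eta alpha => Y (X eta alpha) alpha = eta) 0 0 /\
    locally_2d (fun x alpha => X (Y x alpha) alpha = x) 0 0.

Definition parameter_change (B : R -> R) : Prop :=
  B 0 = 0 /\ smooth_near0 B /\
  exists A : R -> R,
    smooth_near0 A /\
    locally 0 (fun alpha => A (B alpha) = alpha) /\
    locally 0 (fun beta => B (A beta) = beta).

(** The family of equations [coef x alpha * x' = rhs x alpha]. *)
Record ql_dae := QLDAE { coef : R -> R -> R; rhs : R -> R -> R }.

Definition holds_at (E : ql_dae) (alpha x v : R) : Prop :=
  coef E x alpha * v = rhs E x alpha.

(** With [x = X eta alpha] one has [x' = X_eta eta alpha * eta']. *)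
Definition substitute (E : ql_dae) (X : R -> R -> R) : ql_dae :=
  QLDAE
    (fun eta alpha => coef E (X eta alpha) alpha * Derive (fun h => X h alpha) eta)
    (fun eta alpha => rhs E (X eta alpha) alpha).

Lemma substitute_curve (E : ql_dae) (X : R -> R -> R) (alpha t : R) (h : R -> R) :
  ex_derive h t -> ex_derive (fun u => X u alpha) (h t) ->
  holds_at (substitute E X) alpha (h t) (Derive h t) <->
  holds_at E alpha (X (h t) alpha) (Derive (fun u => X (h u) alpha) t).
Proof.
intros Hh HX; unfold holds_at; simpl.
rewrite (Derive_comp (fun u => X u alpha) h t HX Hh).
rewrite Rmult_assoc, (Rmult_comm (Derive h t)); reflexivity.
Qed.

Definition with_parameter (E : ql_dae) (B : R -> R) : ql_dae :=
  QLDAE (fun x alpha => coef E x (B alpha)) (fun x alpha => rhs E x (B alpha)).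

(** Equality near the origin after multiplying both sides of [E1] by a
    nowhere vanishing function. *)
Definition same_equation_near0 (E1 E2 : ql_dae) : Prop :=
  exists m : R -> R -> R,
    smooth_2d_near0 m /\
    locally_2d (fun x alpha =>
      m x alpha <> 0 /\
      m x alpha * coef E1 x alpha = coef E2 x alpha /\
      m x alpha * rhs E1 x alpha = rhs E2 x alpha) 0 0.

Definition brought_to (E N : ql_dae) : Prop :=
  exists (X : R -> R -> R) (B : R -> R),
    coordinate_change X /\ parameter_change B /\
    same_equation_near0 (substitute E X) (with_parameter N B).

(** [r eta beta = O(eta^k)] as [eta -> 0], uniformly for small [beta]. *)
Definition bigO_eta (k : nat) (r : R -> R -> R) : Prop :=
  exists C : R, locally_2d (fun eta beta => Rabs (r eta beta) <= C * Rabs eta ^ k) 0 0.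

(* Main.v *)
(** Put [h = g/f], so that the equation is [h(x,alpha) x' = 1] near the origin.
    Since [h_xx <> 0], the implicit function theorem gives the critical point
    [x = p(alpha)] of [h(., alpha)].  With the affine change
    [x = p(alpha) + c(alpha) eta] the coefficient [c h(p + c eta, alpha)] has
    constant term [B(alpha) = c h(p, alpha)], no linear term, and quadratic term
    [c^3 h_xx(p, alpha) / 2], which the choice of [c] makes equal to [s].
    Finally [B'(0) = c(0) h_alpha(0,0) <> 0], so [beta = B(alpha)] is a new
    parameter. *)
Require Import Defs.
From Stdlib Require Import Reals Lra Lia Ranalysis5 ClassicalEpsilon.
From Coquelicot Require Import Coquelicot.
Open Scope R_scope.

(** * Smooth functions of two variables *)

(** An affine change suffices because the form is prescribed only modulo cubic terms: one
    translation and one scale are enough for the two coefficients to be fixed. The scale [c] is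
    itself an implicit function, obtained from a cubic equation by starting at a positive cube root,
    so its smoothness comes with that of [p]. Most of the work lies in smoothness of every order on
    one common neighbourhood, which the implicit function theorem has to deliver for [p], [c] and
    the inverse of [B]. A function of the parameter alone is carried as a two-variable function that
    ignores its first argument, so a single calculus serves both kinds. The remainder has to depend
    on the new parameter, hence the data are composed with the inverse of [B] before it is
    estimated. Its bound, uniform in the parameter, comes from a locally bounded third derivative
    integrated three times from 0. *)

Definition D1 (F : R -> R -> R) (u v : R) : R := Derive (fun z => F z v) u.
Definition D2 (F : R -> R -> R) (u v : R) : R := Derive (fun z => F u z) v.

(** At a single point [ex_diff_n] speaks of nested [Derive] terms without asserting that the inner
    derivatives exist nearby. On a neighbourhood they do exist, so product and chain rules hold at
    all nearby points, as an induction on [n] requires. *)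
Definition ex_diff_near (n : nat) (F : R -> R -> R) (x y : R) : Prop :=
  locally_2d (fun u v => ex_diff_n F n u v) x y.

(** The quantifier over [n] stands inside the neighbourhood, so one neighbourhood serves all orders.
    At the origin this unfolds to [smooth_2d_near0]. *)
Definition smooth_at (F : R -> R -> R) (x y : R) : Prop :=
  locally_2d (fun u v => forall n, ex_diff_n F n u v) x y.

Lemma locally_2d_mono (P Q : R -> R -> Prop) (x y : R) :
  (forall u v, P u v -> Q u v) -> locally_2d P x y -> locally_2d Q x y.
Proof.
intros H; apply locally_2d_impl, locally_2d_forall; exact H.
Qed.

Lemma locally_2d_locally_2d (P : R -> R -> Prop) (x y : R) :
  locally_2d P x y -> locally_2d (fun u v => locally_2d P u v) x y.
Proof.
intros H; apply (locally_2d_impl_strong P); [|exact H].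
apply locally_2d_forall; auto.
Qed.

Lemma locally_2d_subst (S : R -> R -> Prop) (P Q : R -> R -> R) (x y : R) :
  continuity_2d_pt P x y -> continuity_2d_pt Q x y ->
  locally_2d S (P x y) (Q x y) ->
  locally_2d (fun u v => S (P u v) (Q u v)) x y.
Proof.
intros HP HQ [d Hd].
generalize (locally_2d_and _ _ _ _ (HP d) (HQ d)).
apply locally_2d_mono; intros u v [Hu Hv]; auto.
Qed.

Lemma locally_2d_of_snd (P : R -> Prop) (x y : R) :
  locally y P -> locally_2d (fun _ v => P v) x y.
Proof.
intros [d Hd]; exists d; intros u v _ Hv; apply Hd; exact Hv.
Qed.

Lemma locally_and (P Q : R -> Prop) (y : R) :
  locally y P -> locally y Q -> locally y (fun v => P v /\ Q v).
Proof. apply filter_and. Qed.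

(** * Closure properties at finite order *)

Lemma ex_diff_near_ext (n : nat) (F G : R -> R -> R) (x y : R) :
  locally_2d (fun u v => F u v = G u v) x y ->
  ex_diff_near n F x y -> ex_diff_near n G x y.
Proof.
intros E H.
generalize (locally_2d_and _ _ _ _ (locally_2d_locally_2d _ _ _ E) H).
apply locally_2d_mono; intros u v [Euv Huv].
exact (ex_diff_n_ext_loc F G n u v Euv Huv).
Qed.

Lemma ex_diff_near_continuity (n : nat) (F : R -> R -> R) (x y : R) :
  ex_diff_near n F x y -> locally_2d (continuity_2d_pt F) x y.
Proof.
apply locally_2d_mono; intros u v H; destruct n; apply H.
Qed.

(** This is the induction step of the closure lemmas: the partial derivatives become separate
    functions, which [ex_diff_near_ext] may then replace by locally equal formulas. *)
Lemma ex_diff_near_S (n : nat) (F : R -> R -> R) (x y : R) :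
  ex_diff_near (S n) F x y <->
  locally_2d (fun u v => continuity_2d_pt F u v /\
    ex_derive (fun z => F z v) u /\ ex_derive (fun z => F u z) v) x y /\
  ex_diff_near n (D1 F) x y /\ ex_diff_near n (D2 F) x y.
Proof.
split.
- intros H; repeat split; generalize H; apply locally_2d_mono; simpl; intros u v K;
    unfold D1, D2; tauto.
- intros (H & H1 & H2).
  generalize (locally_2d_and _ _ _ _ H (locally_2d_and _ _ _ _ H1 H2)).
  apply locally_2d_mono; simpl; unfold D1, D2; intros u v K; tauto.
Qed.

Lemma ex_diff_near_pred (n : nat) (F : R -> R -> R) (x y : R) :
  ex_diff_near (S n) F x y -> ex_diff_near n F x y.
Proof.
apply locally_2d_mono; intros u v; apply ex_diff_n_m; lia.
Qed.

(** The classical criterion: one partial derivative exists nearby and is continuous at the point,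
    and the other exists at the point. *)
Lemma ex_diff_near_differentiable (n : nat) (F : R -> R -> R) (x y : R) :
  ex_diff_near (S n) F x y ->
  differentiable_pt_lim F x y (D1 F x y) (D2 F x y).
Proof.
intros H; apply filterdiff_differentiable_pt_lim.
apply ex_diff_near_S in H; destruct H as (H & H1 & _).
pose proof (locally_2d_singleton _ _ _ H) as (_ & _ & Hy).
apply (is_derive_filterdiff F x y (D1 F) (D2 F x y)).
- apply locally_2d_locally in H.
  generalize H; apply filter_imp; intros [u v] (_ & Hu & _).
  apply Derive_correct; exact Hu.
- apply Derive_correct; exact Hy.
- apply ex_diff_near_continuity, locally_2d_singleton in H1.
  apply continuity_2d_pt_filterlim in H1. exact H1.
Qed.

Lemma ex_diff_near_const (n : nat) (c x y : R) :
  ex_diff_near n (fun _ _ => c) x y.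
Proof.
revert c x y; induction n as [|n IH]; intros c x y.
- apply locally_2d_forall; intros u v; simpl; split; auto.
  apply continuity_2d_pt_const.
- apply ex_diff_near_S; split; [|split].
  + apply locally_2d_forall; intros u v; split; [apply continuity_2d_pt_const|].
    split; apply ex_derive_const.
  + apply (ex_diff_near_ext n (fun _ _ => 0)); [|apply IH].
    apply locally_2d_forall; intros u v; unfold D1; now rewrite Derive_const.
  + apply (ex_diff_near_ext n (fun _ _ => 0)); [|apply IH].
    apply locally_2d_forall; intros u v; unfold D2; now rewrite Derive_const.
Qed.

Lemma ex_diff_near_fst (n : nat) (x y : R) : ex_diff_near n (fun u _ => u) x y.
Proof.
destruct n as [|n].
- apply locally_2d_forall; intros u v; simpl; split; auto.
  apply continuity_2d_pt_id1.
- apply ex_diff_near_S; split; [|split].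
  + apply locally_2d_forall; intros u v; split; [apply continuity_2d_pt_id1|].
    split; [apply ex_derive_id | apply ex_derive_const].
  + apply (ex_diff_near_ext n (fun _ _ => 1)); [|apply ex_diff_near_const].
    apply locally_2d_forall; intros u v; unfold D1; now rewrite Derive_id.
  + apply (ex_diff_near_ext n (fun _ _ => 0)); [|apply ex_diff_near_const].
    apply locally_2d_forall; intros u v; unfold D2; now rewrite Derive_const.
Qed.

Lemma ex_diff_near_snd (n : nat) (x y : R) : ex_diff_near n (fun _ v => v) x y.
Proof.
destruct n as [|n].
- apply locally_2d_forall; intros u v; simpl; split; auto.
  apply continuity_2d_pt_id2.
- apply ex_diff_near_S; split; [|split].
  + apply locally_2d_forall; intros u v; split; [apply continuity_2d_pt_id2|].
    split; [apply ex_derive_const | apply ex_derive_id].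
  + apply (ex_diff_near_ext n (fun _ _ => 0)); [|apply ex_diff_near_const].
    apply locally_2d_forall; intros u v; unfold D1; now rewrite Derive_const.
  + apply (ex_diff_near_ext n (fun _ _ => 1)); [|apply ex_diff_near_const].
    apply locally_2d_forall; intros u v; unfold D2; now rewrite Derive_id.
Qed.

Lemma ex_diff_near_plus (n : nat) (F G : R -> R -> R) (x y : R) :
  ex_diff_near n F x y -> ex_diff_near n G x y ->
  ex_diff_near n (fun u v => F u v + G u v) x y.
Proof.
revert F G x y; induction n as [|n IH]; intros F G x y HF HG.
- generalize (locally_2d_and _ _ _ _ HF HG); apply locally_2d_mono.
  intros u v [[CF _] [CG _]]; simpl; split; auto.
  now apply continuity_2d_pt_plus.
- apply ex_diff_near_S in HF; apply ex_diff_near_S in HG.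
  destruct HF as (HF & HF1 & HF2), HG as (HG & HG1 & HG2).
  pose proof (locally_2d_and _ _ _ _ HF HG) as H.
  apply ex_diff_near_S; split; [|split].
  + generalize H; apply locally_2d_mono.
    intros u v [(CF & F1 & F2) (CG & G1 & G2)].
    split; [now apply continuity_2d_pt_plus|].
    split; auto_derive; tauto.
  + apply (ex_diff_near_ext n (fun u v => D1 F u v + D1 G u v)); [|now apply IH].
    generalize H; apply locally_2d_mono.
    intros u v [(CF & F1 & F2) (CG & G1 & G2)]; unfold D1.
    now rewrite Derive_plus.
  + apply (ex_diff_near_ext n (fun u v => D2 F u v + D2 G u v)); [|now apply IH].
    generalize H; apply locally_2d_mono.
    intros u v [(CF & F1 & F2) (CG & G1 & G2)]; unfold D2.
    now rewrite Derive_plus.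
Qed.

Lemma ex_diff_near_mult (n : nat) (F G : R -> R -> R) (x y : R) :
  ex_diff_near n F x y -> ex_diff_near n G x y ->
  ex_diff_near n (fun u v => F u v * G u v) x y.
Proof.
revert F G x y; induction n as [|n IH]; intros F G x y HF HG.
- generalize (locally_2d_and _ _ _ _ HF HG); apply locally_2d_mono.
  intros u v [[CF _] [CG _]]; simpl; split; auto.
  now apply continuity_2d_pt_mult.
- pose proof (ex_diff_near_pred _ _ _ _ HF) as HF0.
  pose proof (ex_diff_near_pred _ _ _ _ HG) as HG0.
  apply ex_diff_near_S in HF; apply ex_diff_near_S in HG.
  destruct HF as (HF & HF1 & HF2), HG as (HG & HG1 & HG2).
  pose proof (locally_2d_and _ _ _ _ HF HG) as H.
  apply ex_diff_near_S; split; [|split].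
  + generalize H; apply locally_2d_mono.
    intros u v [(CF & F1 & F2) (CG & G1 & G2)].
    split; [now apply continuity_2d_pt_mult|].
    split; auto_derive; tauto.
  + apply (ex_diff_near_ext n (fun u v => D1 F u v * G u v + F u v * D1 G u v)).
    * generalize H; apply locally_2d_mono.
      intros u v [(CF & F1 & F2) (CG & G1 & G2)]; unfold D1.
      now rewrite Derive_mult.
    * apply ex_diff_near_plus; now apply IH.
  + apply (ex_diff_near_ext n (fun u v => D2 F u v * G u v + F u v * D2 G u v)).
    * generalize H; apply locally_2d_mono.
      intros u v [(CF & F1 & F2) (CG & G1 & G2)]; unfold D2.
      now rewrite Derive_mult.
    * apply ex_diff_near_plus; now apply IH.
Qed.

Lemma continuity_2d_pt_comp_2d (F P Q : R -> R -> R) (x y : R) :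
  continuity_2d_pt F (P x y) (Q x y) ->
  continuity_2d_pt P x y -> continuity_2d_pt Q x y ->
  continuity_2d_pt (fun u v => F (P u v) (Q u v)) x y.
Proof.
intros HF HP HQ eps.
apply (locally_2d_subst (fun a b => Rabs (F a b - F (P x y) (Q x y)) < eps)); auto.
Qed.

Lemma is_derive_differentiable_pt_lim (F : R -> R -> R) (x y l m : R) :
  differentiable_pt_lim F x y l m ->
  is_derive (fun z => F z y) x l /\ is_derive (fun z => F x z) y m.
Proof.
intros H; split; apply is_derive_Reals.
- replace l with (l * 1 + m * 0) by ring.
  apply (derivable_pt_lim_comp_2d F (fun z => z) (fun _ => y)); [exact H| |].
  + apply derivable_pt_lim_id.
  + apply derivable_pt_lim_const.
- replace m with (l * 0 + m * 1) by ring.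
  apply (derivable_pt_lim_comp_2d F (fun _ => x) (fun z => z)); [exact H| |].
  + apply derivable_pt_lim_const.
  + apply derivable_pt_lim_id.
Qed.

(** The chain rule produces sums of products in which the partial derivatives of [F] are composed
    with the same [P] and [Q]; the induction therefore generalises [F] and keeps [P] and [Q]
    fixed. *)
Lemma ex_diff_near_comp (n : nat) (F P Q : R -> R -> R) (x y : R) :
  ex_diff_near n F (P x y) (Q x y) ->
  ex_diff_near n P x y -> ex_diff_near n Q x y ->
  ex_diff_near n (fun u v => F (P u v) (Q u v)) x y.
Proof.
revert F x y; induction n as [|n IH]; intros F x y HF HP HQ;
  pose proof (locally_2d_singleton _ _ _ (ex_diff_near_continuity _ _ _ _ HP)) as CP;
  pose proof (locally_2d_singleton _ _ _ (ex_diff_near_continuity _ _ _ _ HQ)) as CQ.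
- generalize (locally_2d_and _ _ _ _ HP (locally_2d_and _ _ _ _ HQ
    (locally_2d_subst _ P Q x y CP CQ HF))).
  apply locally_2d_mono; intros u v ([KP _] & [KQ _] & [KF _]).
  simpl; split; auto; now apply continuity_2d_pt_comp_2d.
- assert (H : locally_2d (fun u v =>
    differentiable_pt_lim (fun u v => F (P u v) (Q u v)) u v
      (D1 F (P u v) (Q u v) * D1 P u v + D2 F (P u v) (Q u v) * D1 Q u v)
      (D1 F (P u v) (Q u v) * D2 P u v + D2 F (P u v) (Q u v) * D2 Q u v)) x y).
  { generalize (locally_2d_and _ _ _ _ (locally_2d_locally_2d _ _ _ HP)
      (locally_2d_and _ _ _ _ (locally_2d_locally_2d _ _ _ HQ)
      (locally_2d_subst _ P Q x y CP CQ (locally_2d_locally_2d _ _ _ HF)))).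
    apply locally_2d_mono; intros u v (KP & KQ & KF).
    apply differentiable_pt_lim_comp; now apply (ex_diff_near_differentiable n). }
  pose proof (ex_diff_near_pred _ _ _ _ HP) as HP0.
  pose proof (ex_diff_near_pred _ _ _ _ HQ) as HQ0.
  apply ex_diff_near_S in HF; apply ex_diff_near_S in HP; apply ex_diff_near_S in HQ.
  destruct HF as (_ & HF1 & HF2), HP as (_ & HP1 & HP2), HQ as (_ & HQ1 & HQ2).
  apply ex_diff_near_S; split; [|split].
  + generalize H; apply locally_2d_mono; intros u v K; split.
    * apply differentiable_continuity_pt; eexists; eexists; exact K.
    * apply is_derive_differentiable_pt_lim in K; destruct K as [K1 K2].
      split; eexists; [exact K1 | exact K2].
  + apply (ex_diff_near_ext n (fun u v =>
      D1 F (P u v) (Q u v) * D1 P u v + D2 F (P u v) (Q u v) * D1 Q u v)).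
    * generalize H; apply locally_2d_mono; intros u v K.
      apply is_derive_differentiable_pt_lim in K; destruct K as [K1 _].
      symmetry; apply is_derive_unique; exact K1.
    * apply ex_diff_near_plus; apply ex_diff_near_mult; auto.
  + apply (ex_diff_near_ext n (fun u v =>
      D1 F (P u v) (Q u v) * D2 P u v + D2 F (P u v) (Q u v) * D2 Q u v)).
    * generalize H; apply locally_2d_mono; intros u v K.
      apply is_derive_differentiable_pt_lim in K; destruct K as [_ K2].
      symmetry; apply is_derive_unique; exact K2.
    * apply ex_diff_near_plus; apply ex_diff_near_mult; auto.
Qed.

(** * Closure properties for functions smooth near a point *)

Lemma smooth_at_ex_diff_near (F : R -> R -> R) (x y : R) (n : nat) :
  smooth_at F x y -> ex_diff_near n F x y.
Proof. apply locally_2d_mono; auto. Qed.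

(** The outer neighbourhood is chosen before [n]. The inner one, hidden in [ex_diff_near], may
    shrink with [n], since only its centre is used. *)
Lemma smooth_at_intro (F : R -> R -> R) (x y : R) :
  locally_2d (fun u v => forall n, ex_diff_near n F u v) x y -> smooth_at F x y.
Proof.
apply locally_2d_mono; intros u v H n.
exact (locally_2d_singleton _ _ _ (H n)).
Qed.

Lemma smooth_at_locally (F : R -> R -> R) (x y : R) :
  smooth_at F x y -> locally_2d (smooth_at F) x y.
Proof. apply locally_2d_locally_2d. Qed.

Lemma smooth_at_continuity (F : R -> R -> R) (x y : R) :
  smooth_at F x y -> continuity_2d_pt F x y.
Proof.
intros H; exact (proj1 (locally_2d_singleton _ _ _ H 0%nat)).
Qed.

Lemma smooth_at_differentiable (F : R -> R -> R) (x y : R) :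
  smooth_at F x y -> differentiable_pt_lim F x y (D1 F x y) (D2 F x y).
Proof.
intros H; apply (ex_diff_near_differentiable 0), smooth_at_ex_diff_near, H.
Qed.

Lemma smooth_at_is_derive_1 (F : R -> R -> R) (x y : R) :
  smooth_at F x y -> is_derive (fun z => F z y) x (D1 F x y).
Proof.
intros H; apply smooth_at_differentiable, is_derive_differentiable_pt_lim in H; tauto.
Qed.

Lemma smooth_at_is_derive_2 (F : R -> R -> R) (x y : R) :
  smooth_at F x y -> is_derive (fun z => F x z) y (D2 F x y).
Proof.
intros H; apply smooth_at_differentiable, is_derive_differentiable_pt_lim in H; tauto.
Qed.

Lemma smooth_at_D1 (F : R -> R -> R) (x y : R) :
  smooth_at F x y -> smooth_at (D1 F) x y.
Proof.
apply locally_2d_mono; intros u v H n; exact (ex_diff_n_deriv_aux1 F n u v (H (S n))).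
Qed.

Lemma smooth_at_D2 (F : R -> R -> R) (x y : R) :
  smooth_at F x y -> smooth_at (D2 F) x y.
Proof.
apply locally_2d_mono; intros u v H n; exact (ex_diff_n_deriv_aux2 F n u v (H (S n))).
Qed.

Lemma smooth_at_const (c x y : R) : smooth_at (fun _ _ => c) x y.
Proof.
apply smooth_at_intro, locally_2d_forall; intros u v n; apply ex_diff_near_const.
Qed.

Lemma smooth_at_fst (x y : R) : smooth_at (fun u _ => u) x y.
Proof.
apply smooth_at_intro, locally_2d_forall; intros u v n; apply ex_diff_near_fst.
Qed.

Lemma smooth_at_snd (x y : R) : smooth_at (fun _ v => v) x y.
Proof.
apply smooth_at_intro, locally_2d_forall; intros u v n; apply ex_diff_near_snd.
Qed.

Lemma smooth_at_plus (F G : R -> R -> R) (x y : R) :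
  smooth_at F x y -> smooth_at G x y -> smooth_at (fun u v => F u v + G u v) x y.
Proof.
intros HF HG; apply smooth_at_intro.
generalize (locally_2d_and _ _ _ _ (smooth_at_locally _ _ _ HF) (smooth_at_locally _ _ _ HG)).
apply locally_2d_mono; intros u v [KF KG] n.
apply ex_diff_near_plus; now apply smooth_at_ex_diff_near.
Qed.

Lemma smooth_at_mult (F G : R -> R -> R) (x y : R) :
  smooth_at F x y -> smooth_at G x y -> smooth_at (fun u v => F u v * G u v) x y.
Proof.
intros HF HG; apply smooth_at_intro.
generalize (locally_2d_and _ _ _ _ (smooth_at_locally _ _ _ HF) (smooth_at_locally _ _ _ HG)).
apply locally_2d_mono; intros u v [KF KG] n.
apply ex_diff_near_mult; now apply smooth_at_ex_diff_near.
Qed.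

Lemma smooth_at_comp (F P Q : R -> R -> R) (x y : R) :
  smooth_at F (P x y) (Q x y) -> smooth_at P x y -> smooth_at Q x y ->
  smooth_at (fun u v => F (P u v) (Q u v)) x y.
Proof.
intros HF HP HQ; apply smooth_at_intro.
generalize (locally_2d_and _ _ _ _ (smooth_at_locally _ _ _ HP)
  (locally_2d_and _ _ _ _ (smooth_at_locally _ _ _ HQ)
  (locally_2d_subst _ P Q x y (smooth_at_continuity _ _ _ HP)
     (smooth_at_continuity _ _ _ HQ) (smooth_at_locally _ _ _ HF)))).
apply locally_2d_mono; intros u v (KP & KQ & KF) n.
apply ex_diff_near_comp; now apply smooth_at_ex_diff_near.
Qed.

(* The partial derivatives of [P] are again expressions in [P], so C^n gives
   C^(n+1); the hypotheses hold on a neighbourhood that does not depend on [n]. *)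
Lemma smooth_at_bootstrap (P G1 G2 : R -> R -> R) (x y : R) :
  locally_2d (fun u v => continuity_2d_pt P u v /\
    is_derive (fun z => P z v) u (G1 (P u v) v) /\
    is_derive (fun z => P u z) v (G2 (P u v) v) /\
    smooth_at G1 (P u v) v /\ smooth_at G2 (P u v) v) x y ->
  smooth_at P x y.
Proof.
intros H; apply smooth_at_intro.
generalize (locally_2d_locally_2d _ _ _ H); apply locally_2d_mono; clear x y H.
intros x y H n; induction n as [|n IH].
- generalize H; apply locally_2d_mono; intros u v K; simpl; tauto.
- pose proof (locally_2d_singleton _ _ _ H) as (_ & _ & _ & S1 & S2).
  apply ex_diff_near_S; split; [|split].
  + generalize H; apply locally_2d_mono; intros u v (K & K1 & K2 & _).
    split; [exact K|]; split; eexists; [exact K1 | exact K2].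
  + apply (ex_diff_near_ext n (fun u v => G1 (P u v) v)).
    * generalize H; apply locally_2d_mono; intros u v (K & K1 & K2 & _).
      symmetry; now apply is_derive_unique.
    * apply (ex_diff_near_comp n G1 P (fun _ v => v)); auto.
      -- now apply smooth_at_ex_diff_near.
      -- apply ex_diff_near_snd.
  + apply (ex_diff_near_ext n (fun u v => G2 (P u v) v)).
    * generalize H; apply locally_2d_mono; intros u v (K & K1 & K2 & _).
      symmetry; now apply is_derive_unique.
    * apply (ex_diff_near_comp n G2 P (fun _ v => v)); auto.
      -- now apply smooth_at_ex_diff_near.
      -- apply ex_diff_near_snd.
Qed.

Lemma smooth_at_opp (F : R -> R -> R) (x y : R) :
  smooth_at F x y -> smooth_at (fun u v => - F u v) x y.
Proof.
intros HF; apply (smooth_at_comp (fun a _ => - a) F F); auto.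
apply (smooth_at_bootstrap _ (fun _ _ => -1) (fun _ _ => 0)).
apply locally_2d_forall; intros u v; split; [|split; [|split; [|split]]].
- apply continuity_2d_pt_opp, continuity_2d_pt_id1.
- auto_derive; auto; ring.
- exact (is_derive_const _ _).
- apply smooth_at_const.
- apply smooth_at_const.
Qed.

(** The derivative of 1/a is minus the square of 1/a, a polynomial in the function itself, so
    [smooth_at_bootstrap] applies; composition with [F] does the rest. *)
Lemma smooth_at_inv (F : R -> R -> R) (x y : R) :
  smooth_at F x y -> F x y <> 0 -> smooth_at (fun u v => / F u v) x y.
Proof.
intros HF H0; apply (smooth_at_comp (fun a _ => / a) F F); auto.
apply (smooth_at_bootstrap _ (fun a _ => - (a * a)) (fun _ _ => 0)).
generalize (continuity_2d_pt_neq_0 _ _ _ (continuity_2d_pt_id1 (F x y) (F x y)) H0).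
apply locally_2d_mono; intros u v Hu; split; [|split; [|split; [|split]]].
- apply continuity_2d_pt_inv; [apply continuity_2d_pt_id1 | exact Hu].
- auto_derive; auto; field; auto.
- exact (is_derive_const _ _).
- apply smooth_at_opp, smooth_at_mult; apply smooth_at_fst.
- apply smooth_at_const.
Qed.

Lemma smooth_at_minus (F G : R -> R -> R) (x y : R) :
  smooth_at F x y -> smooth_at G x y -> smooth_at (fun u v => F u v - G u v) x y.
Proof.
intros HF HG; apply smooth_at_plus; [exact HF | now apply smooth_at_opp].
Qed.

Lemma smooth_at_pow (F : R -> R -> R) (n : nat) (x y : R) :
  smooth_at F x y -> smooth_at (fun u v => F u v ^ n) x y.
Proof.
intros HF; induction n as [|n IH]; [exact (smooth_at_const 1 x y)|].
now apply (smooth_at_mult F (fun u v => F u v ^ n)).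
Qed.

Lemma smooth_at_subst (F : R -> R -> R) (p : R -> R) (x y : R) :
  smooth_at F (p y) y -> smooth_at (fun _ v => p v) x y ->
  smooth_at (fun _ v => F (p v) v) x y.
Proof.
intros HF Hp; apply (smooth_at_comp F (fun _ v => p v) (fun _ v => v)); auto.
apply smooth_at_snd.
Qed.

(** For a function of the second variable alone, iterating [D2] gives [Derive_n], so two-variable
    smoothness hands down every one-variable derivative. *)
Lemma smooth_near0_of_smooth_at (p : R -> R) :
  smooth_at (fun _ v => p v) 0 0 -> smooth_near0 p.
Proof.
intros H; apply locally_2d_1d_const_x in H.
unfold smooth_near0; generalize H; apply filter_imp; clear H; intros y H.
assert (K : forall n m, ex_diff_n (fun _ v => Derive_n p n v) m 0 y).
{ induction n as [|n IH]; intros m; [apply H|].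
  exact (ex_diff_n_deriv_aux2 _ m 0 y (IH (S m))). }
intros [|n]; [exact I|].
destruct (K n 1%nat) as (_ & _ & K2 & _); exact K2.
Qed.

(** * Rules for partial derivatives *)

Lemma D1_ext_loc (F G : R -> R -> R) (x y : R) :
  locally_2d (fun u v => F u v = G u v) x y -> D1 F x y = D1 G x y.
Proof.
intros H; apply Derive_ext_loc; exact (locally_2d_1d_const_y _ _ _ H).
Qed.

Lemma D2_ext_loc (F G : R -> R -> R) (x y : R) :
  locally_2d (fun u v => F u v = G u v) x y -> D2 F x y = D2 G x y.
Proof.
intros H; apply Derive_ext_loc; exact (locally_2d_1d_const_x _ _ _ H).
Qed.

Lemma D1_plus (F G : R -> R -> R) (x y : R) :
  smooth_at F x y -> smooth_at G x y ->
  D1 (fun u v => F u v + G u v) x y = D1 F x y + D1 G x y.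
Proof.
intros HF HG; apply Derive_plus; eexists; now apply smooth_at_is_derive_1.
Qed.

Lemma D1_mult (F G : R -> R -> R) (x y : R) :
  smooth_at F x y -> smooth_at G x y ->
  D1 (fun u v => F u v * G u v) x y = D1 F x y * G x y + F x y * D1 G x y.
Proof.
intros HF HG; apply Derive_mult; eexists; now apply smooth_at_is_derive_1.
Qed.

Lemma D2_mult (F G : R -> R -> R) (x y : R) :
  smooth_at F x y -> smooth_at G x y ->
  D2 (fun u v => F u v * G u v) x y = D2 F x y * G x y + F x y * D2 G x y.
Proof.
intros HF HG; apply Derive_mult; eexists; now apply smooth_at_is_derive_2.
Qed.

Lemma D1_D1_mult (F G : R -> R -> R) (x y : R) :
  smooth_at F x y -> smooth_at G x y ->
  D1 (D1 (fun u v => F u v * G u v)) x y =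
  D1 (D1 F) x y * G x y + 2 * (D1 F x y * D1 G x y) + F x y * D1 (D1 G) x y.
Proof.
intros HF HG.
pose proof (smooth_at_D1 _ _ _ HF) as HF1; pose proof (smooth_at_D1 _ _ _ HG) as HG1.
rewrite (D1_ext_loc _ (fun u v => D1 F u v * G u v + F u v * D1 G u v)).
- rewrite D1_plus, !D1_mult; try apply smooth_at_mult; auto; ring.
- generalize (locally_2d_and _ _ _ _ (smooth_at_locally _ _ _ HF) (smooth_at_locally _ _ _ HG)).
  apply locally_2d_mono; intros u v [KF KG]; now apply D1_mult.
Qed.

(** * The implicit function theorem *)

Lemma is_derive_pos_increasing (p dp : R -> R) (a b : R) :
  a < b -> (forall t, a <= t <= b -> is_derive p t (dp t) /\ 0 < dp t) -> p a < p b.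
Proof.
intros Hab H.
destruct (MVT_gen p a b dp) as (c & Hc & E).
- rewrite Rmin_left, Rmax_right by lra; intros t Ht; apply H; lra.
- rewrite Rmin_left, Rmax_right by lra; intros t Ht.
  destruct (H t Ht) as [D _]; apply derivable_continuous_pt.
  exists (dp t); apply is_derive_Reals; exact D.
- rewrite Rmin_left, Rmax_right in Hc by lra.
  destruct (H c Hc) as [_ P]; nra.
Qed.

(** Where the [x]-derivative is positive, [F] is strictly increasing in [x], so a sign change on a
    segment gives exactly one root. Trapping the root gives continuity, the differential of [F]
    gives its derivative, and the formula for that derivative gives smoothness. *)
Lemma implicit_function_pos (F : R -> R -> R) (x0 y0 : R) :
  smooth_at F x0 y0 -> F x0 y0 = 0 -> 0 < D1 F x0 y0 ->
  exists p : R -> R, p y0 = x0 /\ (forall x, smooth_at (fun _ v => p v) x y0) /\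
    locally_2d (fun x y => F (p y) y = 0 /\ (F x y = 0 -> x = p y)) x0 y0.
Proof.
intros HF F0 HD.
assert (L : locally_2d (fun u v => smooth_at F u v /\ 0 < D1 F u v) x0 y0).
{ apply locally_2d_and; [now apply smooth_at_locally|].
  pose proof (smooth_at_continuity _ _ _ (smooth_at_D1 _ _ _ HF)) as C.
  generalize (C (mkposreal _ HD)); apply locally_2d_mono; intros u v; simpl.
  intros K; apply Rabs_lt_between in K; lra. }
destruct L as [d Hd].
(* Half the radius keeps the closed segment of radius [e] inside the open box. *)
pose (e := d / 2).
assert (He : 0 < e < d) by (unfold e; pose proof (cond_pos d); lra).
assert (box : forall u v, x0 - e <= u <= x0 + e -> Rabs (v - y0) < d ->
  smooth_at F u v /\ 0 < D1 F u v).
{ intros u v Hu Hv; apply Hd; [apply Rabs_lt_between; lra | exact Hv]. }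
assert (mono : forall a b v, x0 - e <= a -> a < b -> b <= x0 + e ->
  Rabs (v - y0) < d -> F a v < F b v).
{ intros a b v Ha Hab Hb Hv.
  apply (is_derive_pos_increasing (fun z => F z v) (fun z => D1 F z v)); [exact Hab|].
  intros t Ht; destruct (box t v) as [S P]; [lra | exact Hv |].
  split; [now apply smooth_at_is_derive_1 | exact P]. }
assert (y00 : Rabs (y0 - y0) < d).
{ rewrite Rminus_diag, Rabs_R0; apply cond_pos. }
(* A nonzero value keeps its sign nearby; the product covers both signs at once. *)
assert (Cy : forall u v, x0 - e <= u <= x0 + e -> Rabs (v - y0) < d ->
  F u v <> 0 -> locally v (fun w => 0 < F u w * F u v)).
{ intros u v Hu Hv Hn; destruct (box u v Hu Hv) as [S _].
  assert (P : 0 < Rabs (F u v)) by now apply Rabs_pos_lt.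
  generalize (locally_2d_1d_const_x _ _ _ (smooth_at_continuity _ _ _ S (mkposreal _ P))).
  apply filter_imp; simpl; intros w Hw; revert Hw.
  unfold Rabs; destruct (Rcase_abs (F u v)), (Rcase_abs (F u w - F u v)); nra. }
assert (Lo : F (x0 - e) y0 < 0) by (rewrite <- F0; apply mono; lra || exact y00).
assert (Hi : 0 < F (x0 + e) y0) by (rewrite <- F0; apply mono; lra || exact y00).
assert (L : locally y0 (fun v => Rabs (v - y0) < d /\ F (x0 - e) v < 0 /\ 0 < F (x0 + e) v)).
{ apply locally_and; [exists d; intros v Hv; exact Hv|].
  apply locally_and.
  - generalize (Cy (x0 - e) y0 ltac:(lra) y00 ltac:(lra)); apply filter_imp; intros v; nra.
  - generalize (Cy (x0 + e) y0 ltac:(lra) y00 ltac:(lra)); apply filter_imp; intros v; nra. }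
set (U := fun v => Rabs (v - y0) < d /\ F (x0 - e) v < 0 /\ 0 < F (x0 + e) v) in L.
assert (U0 : U y0) by now apply locally_singleton.
(* [epsilon] makes [p] total; its values are controlled only on [U], where a root exists. *)
pose (p := fun v => epsilon (inhabits 0) (fun u => x0 - e <= u <= x0 + e /\ F u v = 0)).
assert (pU : forall v, U v -> x0 - e < p v < x0 + e /\ F (p v) v = 0).
{ intros v (Hv & HL & HH).
  assert (K : x0 - e <= p v <= x0 + e /\ F (p v) v = 0).
  { apply (epsilon_spec (inhabits 0) (fun u => x0 - e <= u <= x0 + e /\ F u v = 0)).
    destruct (IVT_interv (fun u => F u v) (x0 - e) (x0 + e)) as [t Ht];
      [|lra|exact HL|exact HH|exists t; exact Ht].
    intros t Ht; destruct (box t v Ht Hv) as [S _].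
    apply derivable_continuous_pt; exists (D1 F t v).
    now apply is_derive_Reals, smooth_at_is_derive_1. }
  destruct K as [K E]; split; [|exact E].
  assert (p v <> x0 - e) by (intros Q; rewrite Q in E; lra).
  assert (p v <> x0 + e) by (intros Q; rewrite Q in E; lra).
  lra. }
assert (uniq : forall u v, Rabs (v - y0) < d -> x0 - e <= u <= x0 + e ->
  x0 - e <= p v <= x0 + e -> F u v = F (p v) v -> u = p v).
{ intros u v Hv Hu Hp E.
  destruct (Rtotal_order u (p v)) as [K|[K|K]]; [|exact K|].
  - pose proof (mono u (p v) v); lra.
  - pose proof (mono (p v) u v); lra. }
assert (LU : locally y0 (fun v => locally v U)) by now apply locally_locally.
assert (contp : forall v, locally v U -> forall eps : posreal,
  locally v (fun w => Rabs (p w - p v) < eps)).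
{ intros v Uv eps.
  pose proof (locally_singleton _ _ Uv) as Uv0.
  destruct (pU v Uv0) as [Bv Ev]; destruct Uv0 as (Hv & _ & _).
  (* [k] is below [eps] and keeps [p v - k] and [p v + k] in the box. The opposite signs of [F] at
     these two points persist for [w] near [v] and trap [p w] between them. *)
  pose (k := Rmin (eps / 2) (Rmin (p v - (x0 - e)) (x0 + e - p v))).
  assert (Hk : 0 < k < eps /\ k <= p v - (x0 - e) /\ k <= x0 + e - p v).
  { pose proof (cond_pos eps) as Pe; unfold k.
    pose proof (Rmin_l (eps / 2) (Rmin (p v - (x0 - e)) (x0 + e - p v))).
    pose proof (Rmin_r (eps / 2) (Rmin (p v - (x0 - e)) (x0 + e - p v))).
    pose proof (Rmin_l (p v - (x0 - e)) (x0 + e - p v)).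
    pose proof (Rmin_r (p v - (x0 - e)) (x0 + e - p v)).
    assert (0 < Rmin (eps / 2) (Rmin (p v - (x0 - e)) (x0 + e - p v))).
    { repeat apply Rmin_glb_lt; lra. }
    lra. }
  assert (KL : F (p v - k) v < 0) by (rewrite <- Ev; apply mono; lra || exact Hv).
  assert (KH : 0 < F (p v + k) v) by (rewrite <- Ev; apply mono; lra || exact Hv).
  generalize (locally_and _ _ _ Uv (locally_and _ _ _
    (Cy (p v - k) v ltac:(lra) Hv ltac:(lra)) (Cy (p v + k) v ltac:(lra) Hv ltac:(lra)))).
  apply filter_imp; intros w (Uw & WL & WH).
  destruct (pU w Uw) as [Bw Ew]; destruct Uw as (Hw & _ & _).
  assert (p v - k < p w).
  { destruct (Rlt_le_dec (p v - k) (p w)) as [K|[K|K]]; [exact K| |].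
    - pose proof (mono (p w) (p v - k) w); nra.
    - rewrite K in Ew; nra. }
  assert (p w < p v + k).
  { destruct (Rlt_le_dec (p w) (p v + k)) as [K|[K|K]]; [exact K| |].
    - pose proof (mono (p v + k) (p w) w); nra.
    - rewrite <- K in Ew; nra. }
  apply Rabs_lt_between; lra. }
assert (derp : forall v, locally v U ->
  is_derive p v (- D2 F (p v) v / D1 F (p v) v)).
{ intros v Uv.
  pose proof (contp v Uv) as Cv.
  pose proof (locally_singleton _ _ Uv) as Uv0.
  destruct (pU v Uv0) as [Bv Ev]; destruct Uv0 as (Hv & _ & _).
  destruct (box (p v) v ltac:(lra) Hv) as [S P].
  pose proof (smooth_at_differentiable _ _ _ S) as Dif.
  set (l := D1 F (p v) v) in *; set (m := D2 F (p v) v) in *.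
  (* [F] vanishes at both ([p w], [w]) and ([p v], [v]), so differentiability of [F] bounds the
     linear part alone. *)
  assert (est : forall eps : posreal, locally v (fun w =>
    Rabs (l * (p w - p v) + m * (w - v)) <= eps * Rmax (Rabs (p w - p v)) (Rabs (w - v)))).
  { intros eps; destruct (Dif eps) as [r Hr].
    generalize (locally_and _ _ _ (locally_and _ _ _ Uv (Cv r)) (locally_ball v r)).
    apply filter_imp; intros w [[Uw Wp] Wv].
    specialize (Hr (p w) w Wp Wv).
    rewrite Ev, (proj2 (pU w Uw)) in Hr.
    rewrite <- Rabs_Ropp; eapply Rle_trans; [|exact Hr].
    right; f_equal; ring. }
  (* Differentiability with error l/2 first makes [p] Lipschitz at [v]; the
     error term of [est] is then o(|w - v|). *)
  pose (K := 1 + 2 * Rabs m / l).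
  assert (HK : 1 <= K).
  { unfold K; pose proof (Rabs_pos m).
    assert (0 <= 2 * Rabs m / l) by (apply Rdiv_le_0_compat; lra). lra. }
  assert (lip : locally v (fun w => Rmax (Rabs (p w - p v)) (Rabs (w - v)) <= K * Rabs (w - v))).
  { assert (H2 : 0 < l / 2) by lra.
    generalize (est (mkposreal _ H2)); apply filter_imp; simpl; intros w Hw.
    pose proof (Rabs_pos (w - v)) as P1. pose proof (Rabs_pos (p w - p v)) as P2.
    unfold Rmax in *; destruct (Rle_dec (Rabs (p w - p v)) (Rabs (w - v))) as [Q|Q]; [nra|].
    assert (T : l * Rabs (p w - p v) <=
      Rabs (l * (p w - p v) + m * (w - v)) + Rabs m * Rabs (w - v)).
    { rewrite <- (Rabs_pos_eq l) at 1 by lra; rewrite <- !Rabs_mult.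
      replace (l * (p w - p v)) with ((l * (p w - p v) + m * (w - v)) - m * (w - v)) at 1 by ring.
      unfold Rminus at 1; rewrite <- (Rabs_Ropp (m * (w - v))); apply Rabs_triang. }
    assert (T2 : l * Rabs (p w - p v) <= 2 * Rabs m * Rabs (w - v)) by lra.
    apply Rmult_le_reg_l with l; [exact P|].
    unfold K; replace (l * ((1 + 2 * Rabs m / l) * Rabs (w - v)))
      with (l * Rabs (w - v) + 2 * Rabs m * Rabs (w - v)) by (field; lra).
    nra. }
  apply is_derive_Reals.
  intros eps Heps.
  (* With this tolerance the Lipschitz factor [K] cancels, and division by [l * Rabs h] leaves an
     error of at most [eps / 2]. *)
  assert (Hq : 0 < eps * l / (2 * K)).
  { apply Rdiv_lt_0_compat; [nra|lra]. }
  destruct (locally_and _ _ _ lip (est (mkposreal _ Hq))) as [r Hr].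
  exists r; intros h h0 Hh.
  destruct (Hr (v + h)) as [H1 H2].
  { change (Rabs (v + h - v) < r); now replace (v + h - v) with h by ring. }
  simpl in H2; replace (v + h - v) with h in H1, H2 by ring.
  assert (Ph : 0 < Rabs h) by now apply Rabs_pos_lt.
  replace ((p (v + h) - p v) / h - - m / l) with
    ((l * (p (v + h) - p v) + m * h) / (l * h)) by (field; lra).
  rewrite Rabs_div by nra; rewrite Rabs_mult, (Rabs_pos_eq l) by lra.
  apply Rlt_div_l; [nra|].
  assert (H3 : eps * l / (2 * K) * Rmax (Rabs (p (v + h) - p v)) (Rabs h)
     <= eps * l / (2 * K) * (K * Rabs h)) by (apply Rmult_le_compat_l; lra).
  replace (eps * l / (2 * K) * (K * Rabs h)) with (eps * (l * Rabs h) / 2) in H3 by (field; lra).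
  assert (0 < eps * (l * Rabs h)) by (repeat apply Rmult_lt_0_compat; lra).
  lra. }
assert (p0 : p y0 = x0).
{ symmetry; destruct (pU y0 U0) as [B E]; apply uniq; try lra; exact y00. }
exists p; split; [exact p0|split].
(* The derivative -F_y/F_x, taken at ([p v], [v]), is a smooth expression in [p v] and [v], as the
   bootstrap demands. *)
- intros x; apply (smooth_at_bootstrap _ (fun _ _ => 0) (fun u v => - D2 F u v / D1 F u v)).
  generalize (locally_2d_of_snd _ x y0 LU); apply locally_2d_mono; intros u v Uv.
  pose proof (locally_singleton _ _ Uv) as Uv0.
  destruct (pU v Uv0) as [Bv _], Uv0 as (Hv & _ & _).
  destruct (box (p v) v ltac:(lra) Hv) as [S P].
  split; [|split; [|split; [|split]]].
  + intros eps; apply locally_2d_of_snd, contp, Uv.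
  + exact (is_derive_const _ _).
  + now apply derp.
  + apply smooth_at_const.
  + apply smooth_at_mult; [now apply smooth_at_opp, smooth_at_D2|].
    apply smooth_at_inv; [now apply smooth_at_D1 | lra].
- destruct L as [r Hr].
  assert (Hm : 0 < Rmin e r) by (apply Rmin_glb_lt; [lra | apply cond_pos]).
  exists (mkposreal _ Hm); simpl; intros u v Hu Hv.
  pose proof (Rmin_l e r); pose proof (Rmin_r e r).
  assert (Uv : U v) by (apply Hr; change (Rabs (v - y0) < r); lra).
  destruct (pU v Uv) as [B E]; split; [exact E|].
  intros E'; apply Rabs_lt_between in Hu; destruct Uv as [Hv' _].
  apply uniq; lra || exact Hv'.
Qed.

(** A negative derivative is handled by passing to [- F], which has the same zeros. *)
Lemma implicit_function (F : R -> R -> R) (x0 y0 : R) :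
  smooth_at F x0 y0 -> F x0 y0 = 0 -> D1 F x0 y0 <> 0 ->
  exists p : R -> R, p y0 = x0 /\ (forall x, smooth_at (fun _ v => p v) x y0) /\
    locally_2d (fun x y => F (p y) y = 0 /\ (F x y = 0 -> x = p y)) x0 y0.
Proof.
intros HF F0 HD.
destruct (Rtotal_order (D1 F x0 y0) 0) as [N|[N|N]]; [|easy|].
- destruct (implicit_function_pos (fun u v => - F u v) x0 y0) as (p & p0 & Sp & L).
  + now apply smooth_at_opp.
  + lra.
  + unfold D1; rewrite Derive_opp; unfold D1 in N; lra.
  + exists p; split; [exact p0|split; [exact Sp|]].
    generalize L; apply locally_2d_mono; intros u v [E U]; split; [lra|].
    intros E'; apply U; lra.
- now apply implicit_function_pos.
Qed.

(** [A] solves [B u - v = 0] for [u]. Existence of the root makes it a right inverse; uniqueness,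
    read at the point ([v], [B v]), makes it a left inverse. *)
Lemma inverse_function (B : R -> R) :
  B 0 = 0 -> (forall x, smooth_at (fun _ v => B v) x 0) -> Derive B 0 <> 0 ->
  exists A : R -> R, A 0 = 0 /\ (forall x, smooth_at (fun _ v => A v) x 0) /\
    locally 0 (fun v => B (A v) = v) /\ locally 0 (fun v => A (B v) = v).
Proof.
intros B0 SB DB.
assert (SB1 : smooth_at (fun u _ => B u) 0 0).
{ apply (smooth_at_comp (fun _ v => B v) (fun _ v => v) (fun u _ => u)); auto.
  - apply smooth_at_snd.
  - apply smooth_at_fst. }
destruct (implicit_function (fun u v => B u - v) 0 0) as (A & A0 & SA & L).
- apply smooth_at_minus; [exact SB1 | apply smooth_at_snd].
- lra.
- unfold D1; rewrite Derive_minus, Derive_const, Rminus_0_r; auto.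
  + eexists; apply (smooth_at_is_derive_1 _ _ _ SB1).
  + apply ex_derive_const.
- exists A; split; [exact A0|split; [exact SA|split]].
  + generalize (locally_2d_1d_const_x _ _ _ L); apply filter_imp.
    intros v [E _]; lra.
  + assert (L' : locally_2d (fun _ v => A (B v) = v) 0 0).
    { pose proof (locally_2d_subst (fun x y => B (A y) - y = 0 /\ (B x - y = 0 -> x = A y))
        (fun _ v => v) (fun _ v => B v) 0 0) as K.
      cbv beta in K; rewrite B0 in K.
      specialize (K (smooth_at_continuity _ _ _ (smooth_at_snd 0 0))
        (smooth_at_continuity _ _ _ (SB 0)) L).
      generalize K; apply locally_2d_mono; intros u v [_ E]; symmetry; apply E; ring. }
    exact (locally_2d_1d_const_x _ _ _ L').
Qed.

(** * Remainder estimates *)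

Lemma bigO_eta_0 (F : R -> R -> R) : continuity_2d_pt F 0 0 -> bigO_eta 0 F.
Proof.
intros H; exists (Rabs (F 0 0) + 1).
generalize (H (mkposreal 1 Rlt_0_1)); apply locally_2d_mono; simpl; intros u v K.
pose proof (Rabs_triang_inv (F u v) (F 0 0)); lra.
Qed.

(** By the mean value theorem on the segment from 0 to [u], [F u v] equals [u] times the derivative
    at some [t] with |t| at most |u|, which gains one power with a constant independent of [v]. *)
Lemma bigO_eta_primitive (k : nat) (F : R -> R -> R) :
  smooth_at F 0 0 -> locally 0 (fun v => F 0 v = 0) ->
  bigO_eta k (D1 F) -> bigO_eta (S k) F.
Proof.
(* The given [C] may be negative; its absolute value allows |t|^k to be enlarged to |u|^k. *)
intros S Z [C HC]; exists (Rabs C).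
destruct (locally_2d_and _ _ _ _ (smooth_at_locally _ _ _ S)
  (locally_2d_and _ _ _ _ (locally_2d_of_snd _ 0 0 Z) HC)) as [d Hd].
exists d; intros u v Hu Hv; rewrite Rminus_0_r in Hu.
assert (Hd' : forall t, Rmin 0 u <= t <= Rmax 0 u -> Rabs t <= Rabs u /\
  is_derive (fun z => F z v) t (D1 F t v) /\ Rabs (D1 F t v) <= C * Rabs t ^ k).
{ intros t Ht.
  assert (T : Rabs t <= Rabs u).
  { revert Ht; unfold Rmin, Rmax; destruct (Rle_dec 0 u); split_Rabs; lra. }
  split; [exact T|].
  destruct (Hd t v) as (K1 & _ & K2); [rewrite Rminus_0_r; lra | exact Hv |].
  split; [now apply smooth_at_is_derive_1 | exact K2]. }
destruct (MVT_gen (fun z => F z v) 0 u (fun z => D1 F z v)) as (t & Ht & E).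
- intros t Ht; apply Hd'; lra.
- intros t Ht; apply derivable_continuous_pt; exists (D1 F t v).
  apply is_derive_Reals, Hd'; exact Ht.
- destruct (Hd 0 v) as (_ & Z0 & _).
  { rewrite Rminus_0_r, Rabs_R0; apply cond_pos. }
  { exact Hv. }
  rewrite Z0, !Rminus_0_r in E; rewrite E, Rabs_mult; simpl.
  destruct (Hd' t Ht) as (T & _ & B).
  assert (P : Rabs t ^ k <= Rabs u ^ k) by (apply pow_incr; split; [apply Rabs_pos | exact T]).
  pose proof (Rabs_pos u); pose proof (Rabs_pos C); pose proof (Rle_abs C).
  pose proof (pow_le (Rabs t) k (Rabs_pos t)).
  apply (Rle_trans _ (Rabs C * Rabs u ^ k * Rabs u)); [|right; ring].
  apply Rmult_le_compat_r; [lra|]; nra.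
Qed.

(* The functions [q], [k] and [b] stand for [p], [c] and [alpha] expressed in the
   new parameter. *)
Lemma remainder_bigO (h : R -> R -> R) (s : R) (q k b : R -> R) :
  smooth_at h 0 0 -> q 0 = 0 ->
  smooth_at (fun _ v => q v) 0 0 -> smooth_at (fun _ v => k v) 0 0 ->
  smooth_at (fun _ v => b v) 0 0 -> b 0 = 0 ->
  locally 0 (fun v => k v * h (q v) (b v) = v) ->
  locally 0 (fun v => D1 h (q v) (b v) = 0) ->
  locally 0 (fun v => k v ^ 3 * D1 (D1 h) (q v) (b v) = 2 * s) ->
  let r := fun u v => k v * h (q v + k v * u) (b v) - v - s * u ^ 2 in
  smooth_at r 0 0 /\ bigO_eta 3 r.
Proof.
intros S q0 Sq Sk Sb b0 E0 E1 E2 r.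
set (X := fun u v => q v + k v * u).
assert (X0 : X 0 0 = 0) by (unfold X; rewrite q0; ring).
assert (SX : smooth_at X 0 0).
{ apply smooth_at_plus; [exact Sq|]; apply smooth_at_mult; [exact Sk | apply smooth_at_fst]. }
assert (ShX : smooth_at (fun u v => h (X u v) (b v)) 0 0).
{ apply (smooth_at_comp h X (fun _ v => b v)); auto.
  now rewrite X0, b0. }
assert (LS : locally_2d (fun u v => smooth_at h (X u v) (b v)) 0 0).
{ apply (locally_2d_subst (smooth_at h) X (fun _ v => b v)).
  - now apply smooth_at_continuity.
  - now apply smooth_at_continuity.
  - rewrite X0, b0; now apply smooth_at_locally. }
(* [r1] and [r2] are the first two [u]-derivatives of [r] in closed form. By [E0], [E1] and [E2],
   the functions [r], [r1] and [r2] vanish at [u = 0], which permits three integrations. *)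
set (r1 := fun u v => k v ^ 2 * D1 h (X u v) (b v) - 2 * s * u).
set (r2 := fun u v => k v ^ 3 * D1 (D1 h) (X u v) (b v) - 2 * s).
assert (Sr : smooth_at r 0 0).
{ unfold r; apply smooth_at_minus; [apply smooth_at_minus|].
  - apply smooth_at_mult; [exact Sk | exact ShX].
  - apply smooth_at_snd.
  - apply smooth_at_mult; [apply smooth_at_const | apply smooth_at_pow, smooth_at_fst]. }
assert (D1r : locally_2d (fun u v => D1 r u v = r1 u v) 0 0).
{ generalize LS; apply locally_2d_mono; intros u v K; unfold D1, r.
  pose proof (smooth_at_is_derive_1 _ _ _ K) as D; unfold X in D.
  apply is_derive_unique; auto_derive.
  - eexists; exact D.
  - unfold r1, X, D1; ring. }
assert (D1r1 : locally_2d (fun u v => D1 r1 u v = r2 u v) 0 0).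
{ generalize LS; apply locally_2d_mono; intros u v K; unfold D1 at 1, r1, X.
  pose proof (smooth_at_is_derive_1 _ _ _ (smooth_at_D1 _ _ _ K)) as D; unfold X in D.
  apply is_derive_unique; auto_derive.
  - eexists; exact D.
  - unfold r2, X, D1; ring. }
assert (D2r : locally_2d (fun u v => D1 (D1 r) u v = r2 u v) 0 0).
{ generalize (locally_2d_and _ _ _ _ D1r1 (locally_2d_locally_2d _ _ _ D1r)).
  apply locally_2d_mono; intros u v [K1 K2]; rewrite <- K1; now apply D1_ext_loc. }
split; [exact Sr|].
apply bigO_eta_primitive; [exact Sr | |].
{ generalize E0; apply filter_imp; intros v E; unfold r.
  rewrite Rmult_0_r, Rplus_0_r, E; ring. }
apply bigO_eta_primitive; [now apply smooth_at_D1 | |].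
{ generalize (locally_and _ _ _ E1 (locally_2d_1d_const_x _ _ _ D1r)).
  apply filter_imp; intros v [E ->]; unfold r1, X.
  rewrite Rmult_0_r, Rplus_0_r, E; ring. }
apply bigO_eta_primitive; [now apply smooth_at_D1, smooth_at_D1 | |].
{ generalize (locally_and _ _ _ E2 (locally_2d_1d_const_x _ _ _ D2r)).
  apply filter_imp; intros v [E ->]; unfold r2, X.
  rewrite Rmult_0_r, Rplus_0_r, E; ring. }
apply bigO_eta_0, smooth_at_continuity.
now do 3 apply smooth_at_D1.
Qed.

(** * The normal form *)

Lemma cube_root_exists (t : R) : 0 < t -> exists c, 0 < c /\ c ^ 3 = t.
Proof.
intros Ht; exists (Rpower t (/ 3)); split; [apply exp_pos|].
rewrite <- Rpower_pow by apply exp_pos.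
rewrite Rpower_mult; transitivity (Rpower t 1); [|now apply Rpower_1].
f_equal; simpl; lra.
Qed.

(** Two implicit functions: [p] exists since the second derivative of [h] is nonzero, and [c] since
    the cubic has derivative 3 c0^2 h_xx at its root [c0], which is nonzero too. *)
Lemma recentering (h : R -> R -> R) (s : R) :
  smooth_at h 0 0 -> D1 h 0 0 = 0 -> 0 < s * D1 (D1 h) 0 0 ->
  exists p c : R -> R,
    p 0 = 0 /\ c 0 <> 0 /\
    (forall x, smooth_at (fun _ v => p v) x 0) /\
    (forall x, smooth_at (fun _ v => c v) x 0) /\
    locally 0 (fun v => D1 h (p v) v = 0) /\
    locally 0 (fun v => c v ^ 3 * D1 (D1 h) (p v) v = 2 * s).
Proof.
intros S h1 h2.
pose proof (smooth_at_D1 _ _ _ S) as S1.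
pose proof (smooth_at_D1 _ _ _ S1) as S2.
assert (hn : D1 (D1 h) 0 0 <> 0) by (intros E; rewrite E in h2; lra).
destruct (implicit_function (D1 h) 0 0 S1 h1 hn) as (p & p0 & Sp & Lp).
destruct (cube_root_exists (2 * s / D1 (D1 h) 0 0)) as (c0 & c0p & c0E).
(* With the denominator made a square, positivity is read off the hypothesis on [s]. *)
{ replace (2 * s / D1 (D1 h) 0 0)
    with (2 * (s * D1 (D1 h) 0 0) / (D1 (D1 h) 0 0 * D1 (D1 h) 0 0)) by (field; auto).
  apply Rdiv_lt_0_compat; nra. }
assert (SH : forall x, smooth_at (fun _ v => D1 (D1 h) (p v) v) x 0).
{ intros x; apply smooth_at_subst; [now rewrite p0 | apply Sp]. }
destruct (implicit_function (fun u v => u ^ 3 * D1 (D1 h) (p v) v - 2 * s) c0 0)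
  as (c & cE & Sc & Lc).
- apply smooth_at_minus; [|apply smooth_at_const].
  apply smooth_at_mult; [apply smooth_at_pow, smooth_at_fst | apply SH].
- rewrite p0, c0E; field; auto.
- unfold D1 at 1.
  rewrite (is_derive_unique _ _ (3 * c0 ^ 2 * D1 (D1 h) 0 0)).
  + apply Rmult_integral_contrapositive_currified; [|exact hn].
    apply Rmult_integral_contrapositive_currified; [lra|].
    apply pow_nonzero; lra.
  + rewrite p0; auto_derive; auto; ring.
- exists p, c; split; [exact p0|split; [rewrite cE; lra|split; [exact Sp|split; [exact Sc|split]]]].
  + generalize (locally_2d_1d_const_x _ _ _ Lp); apply filter_imp; tauto.
  + generalize (locally_2d_1d_const_x _ _ _ Lc); apply filter_imp; intros v [E _]; lra.
Qed.

(* As [h] and [D1 h] vanish at the origin, only the term [c 0 * D2 h 0 0]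
   survives in the derivative. *)
Lemma parameter_nondegenerate (h : R -> R -> R) (p c : R -> R) :
  smooth_at h 0 0 -> h 0 0 = 0 -> D1 h 0 0 = 0 -> D2 h 0 0 <> 0 ->
  p 0 = 0 -> c 0 <> 0 ->
  smooth_at (fun _ v => p v) 0 0 -> smooth_at (fun _ v => c v) 0 0 ->
  Derive (fun v => c v * h (p v) v) 0 <> 0.
Proof.
intros S h0 h1 h2 p0 c0 Sp Sc.
apply smooth_at_is_derive_2 in Sp; apply smooth_at_is_derive_2 in Sc.
apply smooth_at_differentiable in S.
assert (E : is_derive (fun v => h (p v) v) 0 (D2 h 0 0)).
{ apply is_derive_Reals.
  replace (D2 h 0 0) with (D1 h 0 0 * D2 (fun _ v => p v) 0 0 + D2 h 0 0 * 1)
    by (rewrite h1; ring).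
  apply (derivable_pt_lim_comp_2d h p (fun v => v)).
  - now rewrite p0.
  - now apply is_derive_Reals.
  - apply derivable_pt_lim_id. }
rewrite (Derive_mult c (fun v => h (p v) v)); [|eexists; exact Sc|eexists; exact E].
assert (DE : Derive (fun v => h (p v) v) 0 = D2 h 0 0) by now apply is_derive_unique.
rewrite DE, p0, h0, Rmult_0_r, Rplus_0_l.
now apply Rmult_integral_contrapositive_currified.
Qed.

Lemma coordinate_change_affine (p c : R -> R) :
  p 0 = 0 -> c 0 <> 0 ->
  smooth_at (fun _ v => p v) 0 0 -> smooth_at (fun _ v => c v) 0 0 ->
  coordinate_change (fun u v => p v + c v * u).
Proof.
intros p0 c0 Sp Sc.
pose proof (continuity_2d_pt_neq_0 _ _ _ (smooth_at_continuity _ _ _ Sc) c0) as Lc.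
split; [rewrite p0; ring|split].
- apply smooth_at_plus; [exact Sp|]; apply smooth_at_mult; [exact Sc | apply smooth_at_fst].
- exists (fun u v => (u - p v) * / c v); split; [|split].
  + apply smooth_at_mult; [|now apply smooth_at_inv].
    apply smooth_at_minus; [apply smooth_at_fst | exact Sp].
  + generalize Lc; apply locally_2d_mono; intros u v K; field; exact K.
  + generalize Lc; apply locally_2d_mono; intros u v K; field; exact K.
Qed.

Lemma normal_form_of_quotient (f g : R -> R -> R) (s : R) :
  let h := fun u v => g u v / f u v in
  smooth_at f 0 0 -> f 0 0 <> 0 ->
  smooth_at h 0 0 -> h 0 0 = 0 -> D1 h 0 0 = 0 ->
  0 < s * D1 (D1 h) 0 0 -> D2 h 0 0 <> 0 ->
  exists r : R -> R -> R,
    smooth_2d_near0 r /\ bigO_eta 3 r /\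
    brought_to (QLDAE g f)
      (QLDAE (fun eta beta => beta + s * eta ^ 2 + r eta beta) (fun _ _ => 1)).
Proof.
intros h Sf f0 S h0 h1 h2 ha.
destruct (recentering h s S h1 h2) as (p & c & p0 & c0 & Sp & Sc & Lp & Lc).
set (B := fun v => c v * h (p v) v).
assert (B0 : B 0 = 0) by (unfold B; rewrite p0, h0; ring).
assert (SB : forall x, smooth_at (fun _ v => B v) x 0).
{ intros x; apply smooth_at_mult; [apply Sc|].
  apply smooth_at_subst; [now rewrite p0 | apply Sp]. }
destruct (inverse_function B B0 SB) as (A & A0 & SA & BA & AB).
{ now apply parameter_nondegenerate. }
(* [A] is continuous and fixes 0, so what holds for small old parameters holds at [A v] for small
   new ones. *)
assert (pull : forall P : R -> Prop, locally 0 P -> locally 0 (fun v => P (A v))).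
{ intros P HP.
  assert (L : locally_2d (fun _ w => P w) 0 (A 0)) by (apply locally_2d_of_snd; now rewrite A0).
  apply (locally_2d_1d_const_x (fun _ v => P (A v)) 0 0).
  apply (locally_2d_subst (fun _ w => P w) (fun u _ => u) (fun _ v => A v)); [| |exact L].
  - apply continuity_2d_pt_id1.
  - now apply smooth_at_continuity. }
assert (SAc : forall q, (forall x, smooth_at (fun _ v => q v) x 0) ->
  smooth_at (fun _ v => q (A v)) 0 0).
{ intros q Sq; apply (smooth_at_subst (fun u _ => q u)); [rewrite A0 | apply SA].
  apply (smooth_at_comp (fun _ v => q v) (fun _ v => v) (fun u _ => u)); auto.
  - apply smooth_at_snd.
  - apply smooth_at_fst. }
(* In the new parameter the constant term is [B (A v)], so the hypothesis on it is [BA]. *)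
destruct (remainder_bigO h s (fun v => p (A v)) (fun v => c (A v)) A) as [Sr Or]; auto.
{ now rewrite A0. }
{ exact (pull _ Lp). }
{ exact (pull _ Lc). }
eexists; split; [exact Sr|split; [exact Or|]].
set (X := fun u v => p v + c v * u).
pose proof (coordinate_change_affine p c p0 c0 (Sp 0) (Sc 0)) as CX.
assert (SX : smooth_at X 0 0) by apply CX.
assert (X0 : X 0 0 = 0) by apply CX.
assert (SfX : smooth_at (fun u v => f (X u v) v) 0 0).
{ apply (smooth_at_comp f X (fun _ v => v)); auto.
  - now rewrite X0.
  - apply smooth_at_snd. }
assert (fX0 : f (X 0 0) 0 <> 0) by now rewrite X0.
exists X, B; split; [exact CX|split; [split; [exact B0|split]|]].
- apply smooth_near0_of_smooth_at, SB.
- exists A; split; [apply smooth_near0_of_smooth_at, SA | split; assumption].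
(* Multiplying by 1/f along the change of coordinate turns the right-hand side into 1 and [g] into
   [h]. *)
- exists (fun u v => / f (X u v) v); split; [now apply smooth_at_inv|].
  generalize (locally_2d_and _ _ _ _ (locally_2d_of_snd _ 0 0 AB)
    (continuity_2d_pt_neq_0 _ _ _ (smooth_at_continuity _ _ _ SfX) fX0)).
  apply locally_2d_mono; intros u v [E N]; simpl.
  split; [now apply Rinv_neq_0_compat|split; [|now field]].
  (* Once [A (B v)] is [v], the terms subtracted in the remainder cancel the explicit ones and
     [c v * h (X u v) v] is left. *)
  rewrite E.
  replace (Derive (fun t => X t v) u) with (c v).
  + unfold h; fold (X u v); field; exact N.
  + symmetry; apply is_derive_unique; unfold X; auto_derive; auto; ring.
Qed.

Theorem proposition2p7 (f g : R -> R -> R)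
  (hf : smooth_2d f) (hg : smooth_2d g)
  (hg0 : g 0 0 = 0)
  (hgx : partial_derive 1 0 g 0 0 = 0)
  (hgxx : partial_derive 2 0 g 0 0 <> 0)
  (hf0 : f 0 0 <> 0)
  (hga : partial_derive 0 1 g 0 0 <> 0) :
  let s := sign (partial_derive 2 0 g 0 0 / f 0 0) in
  (s = 1 \/ s = -1) /\
  exists r : R -> R -> R,
    smooth_2d_near0 r /\ bigO_eta 3 r /\
    brought_to (QLDAE g f)
      (QLDAE (fun eta beta => beta + s * eta ^ 2 + r eta beta) (fun _ _ => 1)).
Proof.
change (D1 g 0 0 = 0) in hgx; change (D2 g 0 0 <> 0) in hga.
change (partial_derive 2 0 g 0 0) with (D1 (D1 g) 0 0) in *.
intros s.
assert (Sf : smooth_at f 0 0) by (apply locally_2d_forall; auto).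
assert (Sg : smooth_at g 0 0) by (apply locally_2d_forall; auto).
set (h := fun u v => g u v / f u v).
assert (Sh : smooth_at h 0 0) by (apply smooth_at_mult; [|apply smooth_at_inv]; auto).
(* The product [h f] is differentiated instead of the quotient: as [h], and then its [x]-derivative,
   vanish at the origin, each derivative of [g] needed there is the corresponding derivative of [h]
   times [f 0 0]. *)
assert (E : locally_2d (fun u v => g u v = h u v * f u v) 0 0).
{ generalize (continuity_2d_pt_neq_0 _ _ _ (smooth_at_continuity _ _ _ Sf) hf0).
  apply locally_2d_mono; intros u v N; unfold h; field; exact N. }
assert (h0 : h 0 0 = 0) by (unfold h; rewrite hg0; field; exact hf0).
assert (h1 : D1 h 0 0 = 0).
{ rewrite (D1_ext_loc _ _ _ _ E), D1_mult, h0 in hgx; auto.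
  apply Rmult_eq_reg_r with (f 0 0); [lra | exact hf0]. }
assert (h2 : D1 (D1 h) 0 0 = D1 (D1 g) 0 0 / f 0 0).
{ rewrite (D1_ext_loc (D1 g) (D1 (fun u v => h u v * f u v))).
  - rewrite D1_D1_mult, h0, h1 by auto; field; exact hf0.
  - generalize (locally_2d_locally_2d _ _ _ E); apply locally_2d_mono.
    intros u v K; now apply D1_ext_loc. }
assert (ha : D2 h 0 0 <> 0).
{ rewrite (D2_ext_loc _ _ _ _ E), D2_mult, h0 in hga; auto.
  intros K; apply hga; rewrite K; ring. }
assert (sE : s = sign (D1 (D1 h) 0 0)) by (unfold s; now rewrite h2).
clearbody s.
assert (hn : D1 (D1 h) 0 0 <> 0).
{ rewrite h2; apply Rmult_integral_contrapositive_currified; [exact hgxx|].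
  now apply Rinv_neq_0_compat. }
assert (hs : (s = 1 \/ s = -1) /\ 0 < s * D1 (D1 h) 0 0).
{ rewrite sE; destruct (Rtotal_order (D1 (D1 h) 0 0) 0) as [N|[N|N]]; [|easy|].
  - rewrite sign_eq_m1 by exact N; lra.
  - rewrite sign_eq_1 by exact N; lra. }
destruct hs as [s1 hs]; split; [exact s1|].
now apply normal_form_of_quotient.
Qed.
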